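(* Let $\zeta\in\overline{\mathbb{D}}$ and let $\phi(z)=\zeta|z|^{k}z$, where $k\ge 0$, be an analytic function on the unit disc $\mathbb{D}$. Then the Berezin range of the composition operator $C_\phi$ acting on the Bergman space $A^2(\mathbb{D})$ is convex if and only if $\zeta\in[-1,1]$.
   Context: $\mathbb{D}$ is the open unit disc in $\mathbb{C}$ and $\overline{\mathbb{D}}$ its closure. $A^2(\mathbb{D})$ is the Bergman space of holomorphic functions $f$ on $\mathbb{D}$ with $\int_{\mathbb{D}}|f(z)|^2\,dV(z)<\infty$, where $dV$ is the normalized area measure on $\mathbb{D}$. It is a reproducing kernel Hilbert space with kernel $k_w(z)=\frac{1}{(1-\bar w z)^2}$, and $\|k_\lambda\|^2=\frac{1}{(1-|\lambda|^2)^2}$; the normalized kernel is $\hat k_\lambda=k_\lambda/\|k_\lambda\|$. For $\phi:\mathbb{D}\to\mathbb{D}$, the composition operator on $A^2(\mathbb{D})$ is $C_\phi f=f\circ\phi$. The Berezin transform of $C_\phi$ at $\lambda\in\mathbb{D}$ is $\widetilde{C_\phi}(\lambda)=\langle C_\phi\hat k_\lambda,\hat k_\lambda\rangle$, which equals $(1-|\lambda|^2)^2\,k_\lambda(\phi(\lambda))$. The Berezin range of $C_\phi$ is the set $\mathrm{Ber}(C_\phi)=\{\widetilde{C_\phi}(\lambda):\lambda\in\mathbb{D}\}\subseteq\mathbb{C}$. *)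

(* Defs.v *)
From HB Require Import structures.
From mathcomp Require Import all_boot all_order all_algebra.
From mathcomp Require Import all_classical all_reals all_analysis.
From mathcomp Require Import complex.

Set Implicit Arguments.
Unset Strict Implicit.
Unset Printing Implicit Defensive.

Import Order.TTheory GRing.Theory Num.Theory.
Import numFieldNormedType.Exports.

Local Open Scope classical_set_scope.
Local Open Scope ring_scope.
Local Open Scope complex_scope.

(* In R[i] the norm `|z| is again an element of R[i]; normc is R-valued. *)
Definition normc {R : realType} (z : R[i]) : R := complex.Re `|z|.

Definition disc {R : realType} : set R[i] := [set z | normc z < 1].

Definition closed_disc {R : realType} : set R[i] := [set z | normc z <= 1].

(* f is complex differentiable at every point of the open unit disc *)
Definition holomorphic_on_disc {R : realType} (f : R[i] -> R[i]) : Prop :=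
  forall z : R[i], disc z -> derivable (f : R[i]^o -> R[i]^o) z 1.

Definition area {R : realType} :
  {measure set (measurableTypeR R * measurableTypeR R) -> \bar R} :=
  (@lebesgue_measure R \x @lebesgue_measure R)%E.

Definition disc_xy {R : realType} : set (R * R) :=
  [set p | disc (p.1 +i* p.2)].

(* Integral over the disc against the area measure normalized to have total
   mass 1 on the disc, for a complex-valued integrand. *)
Definition dV_integral {R : realType} (h : R[i] -> R[i]) : R[i] :=
  let m : R := fine (area (@disc_xy R)) in
  (m^-1 * \int[area]_(p in disc_xy) complex.Re (h (p.1 +i* p.2))) +i*
  (m^-1 * \int[area]_(p in disc_xy) complex.Im (h (p.1 +i* p.2))).

(* The inner product of A^2(D), which is that of L^2(D, dV). *)
Definition bergman_inner {R : realType} (f g : R[i] -> R[i]) : R[i] :=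
  dV_integral (fun z => f z * (g z)^*).

Definition bergman_norm {R : realType} (f : R[i] -> R[i]) : R :=
  Num.sqrt (complex.Re (bergman_inner f f)).

Definition bergman_kernel {R : realType} (w z : R[i]) : R[i] :=
  1 / (1 - w^* * z) ^+ 2.

Definition normalized_kernel {R : realType} (l z : R[i]) : R[i] :=
  bergman_kernel l z / (bergman_norm (bergman_kernel l))%:C.

Definition composition_operator {R : realType} (phi : R[i] -> R[i])
  (f : R[i] -> R[i]) : R[i] -> R[i] := f \o phi.

Definition berezin_transform {R : realType}
  (T : (R[i] -> R[i]) -> (R[i] -> R[i])) (l : R[i]) : R[i] :=
  bergman_inner (T (normalized_kernel l)) (normalized_kernel l).

Definition berezin_range {R : realType}
  (T : (R[i] -> R[i]) -> (R[i] -> R[i])) : set R[i] :=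
  [set berezin_transform T l | l in disc].

(* Berezin transform of C_phi obtained from the reproducing property
   <f, k_l> = f l.  For holomorphic phi it is
   berezin_transform (composition_operator phi) l; when phi is not holomorphic,
   f \o phi may leave A^2(D), but this expression still makes sense. *)
Definition berezin_pointwise {R : realType} (phi : R[i] -> R[i]) (l : R[i])
  : R[i] :=
  ((1 - normc l ^+ 2) ^+ 2)%:C * bergman_kernel l (phi l).

Definition berezin_pointwise_range {R : realType} (phi : R[i] -> R[i])
  : set R[i] :=
  [set berezin_pointwise phi l | l in disc].

(* Convexity over the real scalars: Rcomplex R is R[i] seen as a real vector
   space, whereas R[i] itself is a module over R[i]. *)
Definition convex_complex {R : realType} (A : set R[i]) : Prop :=
  @convex_set R (Rcomplex R) A.

(* k is an arbitrary real exponent; powR has 0 `^ 0 = 1, so k = 0 gives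
   zeta * z for all z. *)
Definition twisted_power {R : realType} (zeta : R[i]) (k : R) (z : R[i])
  : R[i] :=
  zeta * (normc z `^ k)%:C * z.

(* Main.v *)
(* With r = |l| one has conj(l) phi(l) = zeta r^(k+2), so the pointwise Berezin
   transform depends only on r and traces the curve
   (1-r^2)^2 / (1 - zeta r^(k+2))^2, 0 <= r < 1, from 1 towards 0.  For real
   zeta it is continuous and real-valued, so its range is an interval.  For
   nonreal zeta it meets each ray from 0 at most once; if the range were convex,
   the chord from 1 to the value at r would meet the ray through a fixed point P
   of the curve in P itself, which bounds |Im P| by the modulus at r, and
   this tends to 0 as r -> 1, although Im P <> 0.

   When phi is holomorphic, zeta = 0 or k = 0 (compare radial and tangential
   increments), hence phi z = zeta z, and the integral defining the Berezin
   transform is evaluated by the reproducing property.  That property follows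
   from Stokes (Fubini and the fundamental theorem of calculus), i.e. the
   integrals over the disc of d((1-|z|^2) G) and dbar((1-|z|^2) G) vanish: if
   f z = f c + (z - c) q z, then
     dbar((1-|z|^2) q z / (1 - c conj z)) = - q z (z - c) / (1 - c conj z)^2. *)

Require Import Defs.
From mathcomp Require Import all_boot all_order all_algebra.
From mathcomp Require Import all_classical all_reals all_analysis.
From mathcomp Require Import complex.
From mathcomp Require Import measurable_realfun lebesgue_integral_fubini ring lra.
Import Order.TTheory GRing.Theory Num.Theory.
Import numFieldNormedType.Exports.
Local Open Scope classical_set_scope.
Local Open Scope ring_scope.
Local Open Scope complex_scope.

Set Implicit Arguments.
Unset Strict Implicit.
Unset Printing Implicit Defensive.

Notation Re := complex.Re.
Notation Im := complex.Im.

(** * Real parts, imaginary parts and modulus of complex numbers *)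

Lemma complex_ext (R : realType) (z w : R[i]) : Re z = Re w -> Im z = Im w -> z = w.
Proof. by case: z w => [a b] [c d] /= -> ->. Qed.

Lemma Re_addc (R : realType) (z w : R[i]) : Re (z + w) = Re z + Re w.
Proof. by case: z w => [a b] [c d]. Qed.

Lemma Im_addc (R : realType) (z w : R[i]) : Im (z + w) = Im z + Im w.
Proof. by case: z w => [a b] [c d]. Qed.

Lemma Re_mulc (R : realType) (z w : R[i]) : Re (z * w) = Re z * Re w - Im z * Im w.
Proof. by case: z w => [a b] [c d]. Qed.

Lemma Im_mulc (R : realType) (z w : R[i]) : Im (z * w) = Re z * Im w + Im z * Re w.
Proof. by case: z w => [a b] [c d]. Qed.

Lemma Re_invc (R : realType) (z : R[i]) : Re z^-1 = Re z / (Re z ^+ 2 + Im z ^+ 2).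
Proof. by case: z. Qed.

Lemma Im_invc (R : realType) (z : R[i]) : Im z^-1 = - (Im z / (Re z ^+ 2 + Im z ^+ 2)).
Proof. by case: z. Qed.

Lemma normc_ge0 (R : realType) (z : R[i]) : 0 <= normc z.
Proof. by case: z => a b; apply: sqrtr_ge0. Qed.

Lemma normc_sqr (R : realType) (z : R[i]) : normc z ^+ 2 = Re z ^+ 2 + Im z ^+ 2.
Proof. by case: z => a b; apply: sqr_sqrtr; rewrite addr_ge0 ?sqr_ge0. Qed.

Lemma normcM (R : realType) (z w : R[i]) : normc (z * w) = normc z * normc w.
Proof. exact: Normc.normcM. Qed.

Lemma normcV (R : realType) (z : R[i]) : normc z^-1 = (normc z)^-1.
Proof. exact: Normc.normcV. Qed.

Lemma ler_normcD (R : realType) (z w : R[i]) : normc (z + w) <= normc z + normc w.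
Proof. exact: le_normcD. Qed.

Lemma normc_eq0 (R : realType) (z : R[i]) : (normc z == 0) = (z == 0).
Proof.
apply/eqP/eqP => [|->]; first exact: Normc.eq0_normc.
exact: Normc.normc0.
Qed.

Lemma normc1 (R : realType) : normc (1 : R[i]) = 1.
Proof. exact: Normc.normc1. Qed.

Lemma normcJ (R : realType) (z : R[i]) : normc z^* = normc z.
Proof. by case: z => a b; rewrite /normc /= sqrrN. Qed.

Lemma normc_opp (R : realType) (z : R[i]) : normc (- z) = normc z.
Proof. exact: normcN. Qed.

Lemma normc_real (R : realType) (x : R) : normc x%:C = `|x|.
Proof. by rewrite /normc /= expr0n /= addr0 sqrtr_sqr. Qed.

Lemma Re_le_normc (R : realType) (z : R[i]) : `|Re z| <= normc z.
Proof.
rewrite -(ler_pXn2r (n := 2)) ?nnegrE ?normc_ge0//.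
by rewrite normc_sqr real_normK ?num_real// lerDl sqr_ge0.
Qed.

Lemma Im_le_normc (R : realType) (z : R[i]) : `|Im z| <= normc z.
Proof.
rewrite -(ler_pXn2r (n := 2)) ?nnegrE ?normc_ge0//.
by rewrite normc_sqr real_normK ?num_real// lerDr sqr_ge0.
Qed.

Lemma mulcJ (R : realType) (z : R[i]) : z * z^* = (normc z ^+ 2)%:C.
Proof.
by rewrite normc_sqr; case: z => a b; apply: complex_ext => /=; ring.
Qed.

Lemma normc_sub1_gt0 (R : realType) (w : R[i]) :
  normc w < 1 -> 0 < 1 - normc w <= normc (1 - w).
Proof.
move=> w1; rewrite subr_gt0 w1 /= lerBlDr.
by rewrite -(normc1 R) -{1}(subrK w 1) ler_normcD.
Qed.

Lemma sub1_neq0 (R : realType) (w : R[i]) : normc w < 1 -> 1 - w != 0.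
Proof.
move=> /normc_sub1_gt0 /andP[h1 h2]; rewrite -normc_eq0.
by rewrite gt_eqF// (lt_le_trans h1).
Qed.

(** * Derivatives of complex-valued functions of a real variable *)

Definition is_cderive (R : realType) (f : R -> R[i]) (x : R) (d : R[i]) : Prop :=
  is_derive x 1 (fun t => Re (f t)) (Re d) /\
  is_derive x 1 (fun t => Im (f t)) (Im d).

Lemma is_cderive_cst (R : realType) (c : R[i]) x : is_cderive (fun=> c) x 0.
Proof. by split; apply: is_derive_cst. Qed.

Lemma is_cderiveD (R : realType) (f g : R -> R[i]) x df dg :
  is_cderive f x df -> is_cderive g x dg ->
  is_cderive (fun t => f t + g t) x (df + dg).
Proof.
move=> [f1 f2] [g1 g2]; split.
  by under eq_fun do rewrite Re_addc; rewrite Re_addc; exact: is_deriveD.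
by under eq_fun do rewrite Im_addc; rewrite Im_addc; exact: is_deriveD.
Qed.

Lemma is_cderiveM (R : realType) (f g : R -> R[i]) x df dg :
  is_cderive f x df -> is_cderive g x dg ->
  is_cderive (fun t => f t * g t) x (df * g x + f x * dg).
Proof.
move=> [f1 f2] [g1 g2]; split.
  under eq_fun do rewrite Re_mulc.
  apply: (is_derive_eq (is_deriveB (is_deriveM f1 g1) (is_deriveM f2 g2))).
  by rewrite Re_addc !Re_mulc /GRing.scale/=; ring.
under eq_fun do rewrite Im_mulc.
apply: (is_derive_eq (is_deriveD (is_deriveM f1 g2) (is_deriveM f2 g1))).
by rewrite Im_addc !Im_mulc /GRing.scale/=; ring.
Qed.

Lemma is_cderiveV (R : realType) (f : R -> R[i]) x df :
  f x != 0 -> is_cderive f x df ->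
  is_cderive (fun t => (f t)^-1) x (- df * (f x)^-1 ^+ 2).
Proof.
move=> fx [f1 f2].
pose n t := Re (f t) ^+ 2 + Im (f t) ^+ 2.
have nx : n x != 0 by rewrite /n -normc_sqr sqrf_eq0 normc_eq0.
have dnx : is_derive x 1 n (2 * (Re (f x) * Re df + Im (f x) * Im df)).
  apply: (is_derive_eq (is_deriveD (is_deriveM f1 f1) (is_deriveM f2 f2))).
  by rewrite /GRing.scale/=; ring.
have dnV := is_deriveV nx dnx.
have ReN (z : R[i]) : Re (- z) = - Re z by case: z.
have ImN (z : R[i]) : Im (- z) = - Im z by case: z.
split.
  under eq_fun do rewrite Re_invc.
  apply: (is_derive_eq (is_deriveM f1 dnV)).
  rewrite /GRing.scale/= expr2 !(Re_mulc, Im_mulc, Re_invc, Im_invc, ReN, ImN).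
  by move: nx; rewrite /n => nx; field.
under eq_fun do rewrite Im_invc.
apply: (is_derive_eq (is_deriveN (is_deriveM f2 dnV))).
rewrite /GRing.scale/= expr2 !(Re_mulc, Im_mulc, Re_invc, Im_invc, ReN, ImN).
by move: nx; rewrite /n => nx; field.
Qed.

Lemma is_cderive_eq (R : realType) (f : R -> R[i]) x d d' :
  is_cderive f x d -> d = d' -> is_cderive f x d'.
Proof. by move=> ? <-. Qed.

Lemma is_cderive_inv_affine (R : realType) (f : R -> R[i]) (a : R[i]) x d :
  1 - a * f x != 0 -> is_cderive f x d ->
  is_cderive (fun t => (1 - a * f t)^-1) x (d * (a * ((1 - a * f x)^-1 * (1 - a * f x)^-1))).
Proof.
move=> n0 fd.
have h : is_cderive (fun t => 1 - a * f t) x (0 + (0 * f x + (- a) * d)).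
  under eq_fun do rewrite -mulNr.
  apply: (is_cderiveD (is_cderive_cst 1 x)).
  exact: (is_cderiveM (is_cderive_cst (- a) x) fd).
apply: (is_cderive_eq (is_cderiveV n0 h)).
by rewrite expr2; ring.
Qed.

(* Formal expressions in z, conj z, KU = 1/(1 - a z) and KV = 1/(1 - c conj z),
   closed under the Wirtinger derivatives kd = d/dz and kdbar = d/d(conj z), so
   that regularity, measurability and bounds are obtained by induction. *)
Inductive kexp (R : realType) : Type :=
| KC of R[i] | KZ | KZb | KAdd of kexp R & kexp R | KMul of kexp R & kexp R
| KU | KV.
Arguments KZ {R}.
Arguments KZb {R}.
Arguments KU {R}.
Arguments KV {R}.

Fixpoint keval (R : realType) (a c : R[i]) (e : kexp R) (z : R[i]) : R[i] :=
  match e with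
  | KC w => w
  | KZ => z
  | KZb => z^*
  | KAdd e1 e2 => keval a c e1 z + keval a c e2 z
  | KMul e1 e2 => keval a c e1 z * keval a c e2 z
  | KU => (1 - a * z)^-1
  | KV => (1 - c * z^*)^-1
  end.

Fixpoint kd (R : realType) (a : R[i]) (e : kexp R) : kexp R :=
  match e with
  | KC _ | KZb | KV => KC 0
  | KZ => KC 1
  | KAdd e1 e2 => KAdd (kd a e1) (kd a e2)
  | KMul e1 e2 => KAdd (KMul (kd a e1) e2) (KMul e1 (kd a e2))
  | KU => KMul (KC a) (KMul KU KU)
  end.

Fixpoint kdbar (R : realType) (c : R[i]) (e : kexp R) : kexp R :=
  match e with
  | KC _ | KZ | KU => KC 0
  | KZb => KC 1
  | KAdd e1 e2 => KAdd (kdbar c e1) (kdbar c e2)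
  | KMul e1 e2 => KAdd (KMul (kdbar c e1) e2) (KMul e1 (kdbar c e2))
  | KV => KMul (KC c) (KMul KV KV)
  end.

Lemma sub1Mneq0 (R : realType) (a z : R[i]) : normc a < 1 -> normc z <= 1 -> 1 - a * z != 0.
Proof.
move=> a1 z1; apply: sub1_neq0; rewrite normcM.
by rewrite (le_lt_trans _ a1)// ler_piMr// normc_ge0.
Qed.

(** Chain rule in Wirtinger form, d/dt = v d/dz + conj v d/d(conj z). Staying in the closed disc
    keeps the denominators of [KU] and [KV] nonzero. *)
Lemma keval_line (R : realType) (a c : R[i]) (e : kexp R) (p v : R[i]) (x : R) :
  normc a < 1 -> normc c < 1 -> normc (p + x%:C * v) <= 1 ->
  is_cderive (fun t => keval a c e (p + t%:C * v)) x
    (v * keval a c (kd a e) (p + x%:C * v) +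
     v^* * keval a c (kdbar c e) (p + x%:C * v)).
Proof.
move=> a1 c1 px.
have dz : is_cderive (fun t => p + t%:C * v) x v.
  have dx : is_cderive (fun t : R => t%:C) x 1.
    by split; [exact: is_derive_id|exact: is_derive_cst].
  apply: is_cderive_eq.
    apply: (is_cderiveD (is_cderive_cst p x)).
    exact: (is_cderiveM dx (is_cderive_cst v x)).
  by rewrite mulr0 addr0 add0r mul1r.
have dzb : is_cderive (fun t => (p + t%:C * v)^*) x v^*.
  case: dz => d1 d2; split.
    rewrite (_ : (fun t => _) = (fun t => Re (p + t%:C * v))).
      by rewrite (_ : Re v^* = Re v)//; case: (v).
    by apply/funext => t; case: (p + _).
  rewrite (_ : (fun t => _) = - (fun t => Im (p + t%:C * v))).
    by rewrite (_ : Im v^* = - Im v); [exact: is_deriveN|case: (v)].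
  by apply/funext => t; rewrite -[RHS]/(- Im (p + t%:C * v)); case: (p + _).
elim: e => [w|||e1 h1 e2 h2|e1 h1 e2 h2||] /=.
- by rewrite !mulr0 addr0; apply: is_cderive_cst.
- by rewrite mulr1 mulr0 addr0.
- by rewrite mulr1 mulr0 add0r.
- by apply: (is_cderive_eq (is_cderiveD h1 h2)); ring.
- by apply: (is_cderive_eq (is_cderiveM h1 h2)); ring.
- apply: (is_cderive_eq (is_cderive_inv_affine (sub1Mneq0 a1 px) dz)).
  by rewrite mulr0 addr0.
- have n0 : 1 - c * (p + x%:C * v)^* != 0 by apply: sub1Mneq0 => //; rewrite normcJ.
  apply: (is_cderive_eq (is_cderive_inv_affine n0 dzb)).
  by rewrite mulr0 add0r.
Qed.

(** On the closed disc the denominators have modulus at least 1 - |a| and 1 - |c|; everything else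
    is polynomial in z and conj z. *)
Lemma keval_bounded (R : realType) (a c : R[i]) (e : kexp R) :
  normc a < 1 -> normc c < 1 ->
  exists M, forall z, normc z <= 1 -> normc (keval a c e z) <= M.
Proof.
move=> a1 c1.
have key (w : R[i]) : normc w < 1 -> forall z, normc z <= 1 ->
    normc (1 - w * z)^-1 <= (1 - normc w)^-1.
  move=> w1 z z1; rewrite normcV.
  have wz : normc (w * z) <= normc w by rewrite normcM ler_piMr ?normc_ge0.
  have /andP[h1 h2] := normc_sub1_gt0 (le_lt_trans wz w1).
  rewrite lef_pV2 ?posrE ?subr_gt0// ?(lt_le_trans h1)//.
  by rewrite (le_trans _ h2)// lerD2l lerN2.
elim: e => [w|||e1 [M1 h1] e2 [M2 h2]|e1 [M1 h1] e2 [M2 h2]||] /=.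
- by exists (normc w).
- by exists 1.
- by exists 1 => z; rewrite normcJ.
- exists (M1 + M2) => z z1.
  by rewrite (le_trans (ler_normcD _ _))// lerD ?h1 ?h2.
- exists (M1 * M2) => z z1.
  by rewrite normcM ler_pM ?normc_ge0 ?h1 ?h2.
- by exists (1 - normc a)^-1; apply: key.
- exists (1 - normc c)^-1 => z z1; apply: key => //.
  by rewrite normcJ.
Qed.

Notation mtR := measurableTypeR.

Lemma measurable_keval (R : realType) (a c : R[i]) (e : kexp R) :
  measurable_fun setT (fun p : mtR R * mtR R => Re (keval a c e (p.1 +i* p.2)) : mtR R) /\
  measurable_fun setT (fun p : mtR R * mtR R => Im (keval a c e (p.1 +i* p.2)) : mtR R).
Proof.
pose cmeas (f : mtR R * mtR R -> R[i]) :=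
  measurable_fun setT (fun p => Re (f p)) /\ measurable_fun setT (fun p => Im (f p)).
have mc w : cmeas (fun=> w) by split; apply: measurable_cst.
have mD f g : cmeas f -> cmeas g -> cmeas (fun p => f p + g p).
  move=> [f1 f2] [g1 g2]; split.
    under eq_fun do rewrite Re_addc.
    exact: measurable_funD.
  under eq_fun do rewrite Im_addc.
  exact: measurable_funD.
have mM f g : cmeas f -> cmeas g -> cmeas (fun p => f p * g p).
  move=> [f1 f2] [g1 g2]; split.
    under eq_fun do rewrite Re_mulc.
    by apply: measurable_funB; apply: measurable_funM.
  under eq_fun do rewrite Im_mulc.
  by apply: measurable_funD; apply: measurable_funM.
have mV f : cmeas f -> cmeas (fun p => (f p)^-1).
  move=> [f1 f2].
  have mn : measurable_fun setT (fun p => (Re (f p) ^+ 2 + Im (f p) ^+ 2)^-1).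
    (* The inverse of a nonnegative real is written as the power -1, which is measurable on all of
       R, including at 0. *)
    under eq_fun => p do rewrite -powR_inv1 ?addr_ge0 ?sqr_ge0//.
    apply: (measurableT_comp (measurable_powR _)).
    by apply: measurable_funD; apply: measurable_funX.
  split.
    under eq_fun do rewrite Re_invc.
    exact: measurable_funM.
  under eq_fun do rewrite Im_invc.
  exact/measurable_funN/measurable_funM.
have mz : cmeas (fun p => p.1 +i* p.2) by split; [exact: measurable_fst|exact: measurable_snd].
have mzb : cmeas (fun p => (p.1 +i* p.2)^*).
  split; first exact: measurable_fst.
  apply: (@measurable_funN _ _ R setT snd); exact: measurable_snd.
rewrite -/(cmeas _).
elim: e => [w|||e1 h1 e2 h2|e1 h1 e2 h2||] /=.
- exact: mc.
- exact: mz.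
- exact: mzb.
- exact: mD.
- exact: mM.
- rewrite (_ : (fun p => _) = (fun p => (1 + (-1) * (a * (p.1 +i* p.2)))^-1)).
    exact: (mV _ (mD _ _ (mc _) (mM _ _ (mc _) (mM _ _ (mc _) mz)))).
  by apply/funext => p; congr (_^-1); ring.
- rewrite (_ : (fun p => _) = (fun p => (1 + (-1) * (c * (p.1 +i* p.2)^*))^-1)).
    exact: (mV _ (mD _ _ (mc _) (mM _ _ (mc _) (mM _ _ (mc _) mzb)))).
  by apply/funext => p; congr (_^-1); ring.
Qed.

(** * Integration over the disc *)

Lemma normc_lt1 (R : realType) (x y : R) : (normc (x +i* y) < 1) = (x ^+ 2 + y ^+ 2 < 1).
Proof. by rewrite -(normc_sqr (x +i* y)) expr_lt1// normc_ge0. Qed.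

Lemma measurable_disc_xy (R : realType) : measurable (@disc_xy R : set (mtR R * mtR R)).
Proof.
rewrite (_ : disc_xy = [set p : mtR R * mtR R | p.1 ^+ 2 + p.2 ^+ 2 < 1]); last first.
  by apply/seteqP; split => -[x y]; rewrite /disc_xy/disc/= normc_lt1.
have h : measurable_fun setT (fun p : mtR R * mtR R => p.1 ^+ 2 + p.2 ^+ 2 < 1).
  apply: measurable_fun_ltr => //; apply: measurable_funD; apply: measurable_funX.
    exact: measurable_fst.
  exact: measurable_snd.
by have := h measurableT [set true] I; rewrite setTI.
Qed.

Lemma area_setX (R : realType) (A B : set (mtR R)) : measurable A -> measurable B ->
  area (A `*` B) = (lebesgue_measure A * lebesgue_measure B)%E.
Proof. by move=> mA mB; apply: product_measure1E. Qed.

Lemma area_disc_lty (R : realType) : (area (@disc_xy R) < +oo)%E.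
Proof.
apply: (@le_lt_trans _ _ (area (`[-1, 1] `*` `[-1, 1] : set (mtR R * mtR R)))).
  apply: le_measure; rewrite ?inE.
  - exact: measurable_disc_xy.
  - by apply: measurableX; exact: measurable_itv.
  - move=> [x y]; rewrite /disc_xy/disc/= normc_lt1 !in_itv/= => h.
    by split; apply/andP; split; nra.
rewrite area_setX; [|exact: measurable_itv..].
by rewrite !lebesgue_measure_itv/=; case: ifP => _ /=; rewrite ?mule0// -?EFinB -?EFinM ltry.
Qed.

Lemma area_disc_gt0 (R : realType) : (0 < area (@disc_xy R))%E.
Proof.
apply: (@lt_le_trans _ _ (area (`[0, 2^-1] `*` `[0, 2^-1] : set (mtR R * mtR R)))).
  rewrite area_setX; [|exact: measurable_itv..].
  by rewrite !lebesgue_measure_itv/= lte_fin invr_gt0 ltr0n/= -!EFinD -EFinM lte_fin; nra.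
apply: le_measure; rewrite ?inE.
- by apply: measurableX; exact: measurable_itv.
- exact: measurable_disc_xy.
- move=> [x y]; rewrite /disc_xy/disc/= normc_lt1 !in_itv/= => -[/andP[? ?] /andP[? ?]].
  by nra.
Qed.

(** The area enters only as a nonzero finite factor, to be cancelled by the normalization in
    [dV_integral]. *)
Lemma fine_area_gt0 (R : realType) : 0 < fine (area (@disc_xy R)).
Proof. by rewrite fine_gt0// area_disc_gt0 area_disc_lty. Qed.

Lemma integrable_keval (R : realType) (a c : R[i]) (e : kexp R) :
  normc a < 1 -> normc c < 1 ->
  area.-integrable (@disc_xy R) (EFin \o (fun p => Re (keval a c e (p.1 +i* p.2)))) /\
  area.-integrable (@disc_xy R) (EFin \o (fun p => Im (keval a c e (p.1 +i* p.2)))).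
Proof.
move=> a1 c1; have [m1 m2] := measurable_keval a c e.
have [M hM] := keval_bounded e a1 c1.
split; apply: measurable_bounded_integrable.
- exact: measurable_disc_xy.
- exact: area_disc_lty.
- exact: measurable_funTS.
- exists M; split; first exact: num_real.
  move=> N MN p dp /=; apply: ltW; apply: le_lt_trans MN.
  by apply: le_trans (Re_le_normc _) (hM _ _); apply: ltW.
- exact: measurable_disc_xy.
- exact: area_disc_lty.
- exact: measurable_funTS.
- exists M; split; first exact: num_real.
  move=> N MN p dp /=; apply: ltW; apply: le_lt_trans MN.
  by apply: le_trans (Im_le_normc _) (hM _ _); apply: ltW.
Qed.

Lemma disc_slice (R : realType) (x y : R) : disc_xy (x, y) <->
  (y ^+ 2 < 1 /\ x \in `]- Num.sqrt (1 - y ^+ 2), Num.sqrt (1 - y ^+ 2)[).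
Proof.
rewrite /disc_xy/disc/= normc_lt1 in_itv/= -ltr_norml; split => [h|[y1 h]].
  have y1 : y ^+ 2 < 1 by nra.
  split => //; rewrite -sqrtr_sqr ltr_sqrt ?subr_gt0//; lra.
by move: h; rewrite -sqrtr_sqr ltr_sqrt ?subr_gt0//; lra.
Qed.

Lemma disc_slice_integral (R : realType) (f : R -> R) (y : R) :
  (y ^+ 2 < 1 ->
    (\int[lebesgue_measure]_(x in `](- Num.sqrt (1 - y ^+ 2))%R, (Num.sqrt (1 - y ^+ 2))%R[)
       (f x)%:E = 0)%E) ->
  (\int[lebesgue_measure]_x (if (x, y) \in (@disc_xy R) then (f x)%:E else 0) = 0)%E.
Proof.
move=> h; have [y1|y1] := boolP (y ^+ 2 < 1); last first.
  apply: integral0_eq => x _; case: ifPn => // /set_mem /disc_slice[]; by rewrite (negbTE y1).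
rewrite -{}[RHS](h y1) [RHS]integral_mkcond; apply: eq_integral => x _.
rewrite patchE; congr (if _ then _ else _).
apply/idP/idP => [/set_mem/disc_slice[_ ?]|/set_mem xs]; first exact/mem_set.
by apply/mem_set/disc_slice; split.
Qed.

Lemma disc_fubini_x (R : realType) (f : R * R -> R) :
  area.-integrable (@disc_xy R) (EFin \o f) ->
  (forall y, y ^+ 2 < 1 ->
    (\int[lebesgue_measure]_(x in `](- Num.sqrt (1 - y ^+ 2))%R, (Num.sqrt (1 - y ^+ 2))%R[)
       (f (x, y))%:E = 0)%E) ->
  \int[area]_(p in @disc_xy R) f p = 0.
Proof.
move=> fi h; rewrite /Rintegral integral_mkcond /area.
have fi' := (integrable_mkcond _ (@measurable_disc_xy R)).1 fi.
rewrite -(integral21_prod_meas1 fi') integral0_eq// => y _.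
rewrite /fubini_G -[RHS](disc_slice_integral (h y)).
by apply: eq_integral => x _; rewrite patchE.
Qed.

Lemma disc_fubini_y (R : realType) (f : R * R -> R) :
  area.-integrable (@disc_xy R) (EFin \o f) ->
  (forall x, x ^+ 2 < 1 ->
    (\int[lebesgue_measure]_(y in `](- Num.sqrt (1 - x ^+ 2))%R, (Num.sqrt (1 - x ^+ 2))%R[)
       (f (x, y))%:E = 0)%E) ->
  \int[area]_(p in @disc_xy R) f p = 0.
Proof.
move=> fi h; rewrite /Rintegral integral_mkcond /area.
have fi' := (integrable_mkcond _ (@measurable_disc_xy R)).1 fi.
rewrite -(integral12_prod_meas1 fi') integral0_eq// => x _.
rewrite /fubini_F -[RHS](disc_slice_integral (h x)).
apply: eq_integral => y _; rewrite patchE; congr (if _ then _ else _).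
(* [disc_slice_integral] describes horizontal slices; the symmetry of the disc under exchange of
   coordinates transfers it to vertical ones. *)
by apply/idP/idP => /set_mem; rewrite /disc_xy/disc/= !normc_lt1 addrC => ?;
  apply/mem_set; rewrite /disc_xy/disc/= normc_lt1.
Qed.

Lemma integral_derive_itv0 (R : realType) (g dg : R -> R) (s : R) : 0 < s ->
  (forall x, x \in `[-s, s] -> is_derive x 1 g (dg x)) ->
  (forall x, x \in `[-s, s] -> derivable dg x 1) ->
  g s = 0 -> g (- s) = 0 ->
  (\int[lebesgue_measure]_(x in `](- s)%R, s[) (dg x)%:E = 0)%E.
Proof.
move=> s0 hg hdg gs gms.
have ss : - s < s by lra.
have sub x : x \in `]-s, s[ -> x \in `[-s, s].
  by rewrite !in_itv/= => /andP[/ltW -> /ltW ->].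
have cdg : {within `[-s, s], continuous dg}.
  by apply: derivable_within_continuous => x xs; apply: hdg.
have cg x : x \in `[-s, s] -> {for x, continuous g}.
  move=> xs; apply: differentiable_continuous.
  by apply/derivable1_diffP; have [] := hg x xs.
rewrite -(@integral_itv_bndoo _ _ _ _ true false); last first.
  apply/measurable_EFinP; apply: (@measurable_funS _ _ _ _ `[-s, s]) => //.
  exact: subspace_continuous_measurable_fun.
rewrite (@continuous_FTC2 R dg g)//.
- by rewrite gs gms subee.
- split.
  + move=> x xs; by have [] := hg x (sub x xs).
  + apply: cvg_at_right_filter; apply: cg; rewrite in_itv/=; lra.
  + apply: cvg_at_left_filter; apply: cg; rewrite in_itv/=; lra.
- move=> x xs; rewrite derive1E; apply: derive_val.
  by apply: hg; exact: sub.
Qed.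

(* The derivative of e in the real direction v. *)
Definition kdir (R : realType) (a c v : R[i]) (e : kexp R) : kexp R :=
  KAdd (KMul (KC v) (kd a e)) (KMul (KC v^*) (kdbar c e)).

(** The modulus hypothesis makes the segment |x| <= s a chord with both ends on the unit circle.
    There [e] vanishes, so its derivative along the chord integrates to 0. *)
Lemma integral_kdir_line (R : realType) (a c : R[i]) (e : kexp R) (p v : R[i]) (s : R) :
  normc a < 1 -> normc c < 1 -> 0 < s ->
  (forall x : R, normc (p + x%:C * v) ^+ 2 = 1 - s ^+ 2 + x ^+ 2) ->
  (forall z, normc z = 1 -> keval a c e z = 0) ->
  (\int[lebesgue_measure]_(x in `](- s)%R, s[)
     (Re (keval a c (kdir a c v e) (p + x%:C * v)))%:E = 0)%E /\
  (\int[lebesgue_measure]_(x in `](- s)%R, s[)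
     (Im (keval a c (kdir a c v e) (p + x%:C * v)))%:E = 0)%E.
Proof.
move=> a1 c1 s0 pv e0.
have le1 x : x \in `[-s, s] -> normc (p + x%:C * v) <= 1.
  rewrite in_itv/= => xs; rewrite -(expr_le1 (n := 2))// ?normc_ge0//.
  by rewrite pv; nra.
have h x (xs : x \in `[-s, s]) := keval_line e a1 c1 (le1 x xs).
(* [kdir] returns an expression again, hence is itself differentiable along the chord; this gives
   the continuity of the integrand. *)
have h' x (xs : x \in `[-s, s]) := keval_line (kdir a c v e) a1 c1 (le1 x xs).
have end0 x : x ^+ 2 = s ^+ 2 -> keval a c e (p + x%:C * v) = 0.
  move=> xs; apply: e0; apply/eqP; rewrite -(@eqrXn2 _ 2)// ?normc_ge0//.
  by rewrite pv xs subrK expr1n.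
split.
- apply: (@integral_derive_itv0 _ (fun x => Re (keval a c e (p + x%:C * v)))) => //.
  + by move=> x xs; have [] := h x xs.
  + by move=> x xs; have [[]] := h' x xs.
  + by rewrite end0.
  + by rewrite end0// sqrrN.
- apply: (@integral_derive_itv0 _ (fun x => Im (keval a c e (p + x%:C * v)))) => //.
  + by move=> x xs; have [] := h x xs.
  + by move=> x xs; have [_ []] := h' x xs.
  + by rewrite end0.
  + by rewrite end0// sqrrN.
Qed.

(** * Stokes formula on the disc, without the normalizing factor *)

Definition disc_integral (R : realType) (h : R[i] -> R[i]) : R[i] :=
  (\int[area]_(p in disc_xy) Re (h (p.1 +i* p.2))) +i*
  (\int[area]_(p in disc_xy) Im (h (p.1 +i* p.2))).

Lemma eq_disc_integral (R : realType) (f g : R[i] -> R[i]) :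
  (forall z, normc z < 1 -> f z = g z) -> disc_integral f = disc_integral g.
Proof.
move=> fg; apply: complex_ext; apply: eq_Rintegral => -[x y] /set_mem dp /=;
  by rewrite fg.
Qed.

Lemma disc_integralD (R : realType) (a c : R[i]) (e1 e2 : kexp R) :
  normc a < 1 -> normc c < 1 ->
  disc_integral (keval a c (KAdd e1 e2)) =
  disc_integral (keval a c e1) + disc_integral (keval a c e2).
Proof.
move=> a1 c1; have [i1 i2] := integrable_keval e1 a1 c1.
have [j1 j2] := integrable_keval e2 a1 c1.
apply: complex_ext; rewrite /= .
  under eq_Rintegral do rewrite Re_addc.
  by rewrite RintegralD//; exact: measurable_disc_xy.
under eq_Rintegral do rewrite Im_addc.
by rewrite RintegralD//; exact: measurable_disc_xy.
Qed.

Lemma disc_integralZ (R : realType) (a c w : R[i]) (e : kexp R) :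
  normc a < 1 -> normc c < 1 ->
  disc_integral (keval a c (KMul (KC w) e)) = w * disc_integral (keval a c e).
Proof.
move=> a1 c1; have [i1 i2] := integrable_keval e a1 c1.
have mD := @measurable_disc_xy R.
have Z k (f : R * R -> R) : area.-integrable disc_xy (EFin \o f) ->
    area.-integrable disc_xy (EFin \o (fun p => k * f p)).
  by move=> fi; exact: (integrableZl mD k fi).
apply: complex_ext; rewrite ?Re_mulc ?Im_mulc /=.
  under eq_Rintegral do rewrite Re_mulc.
  by rewrite RintegralB ?RintegralZl//; exact: Z.
under eq_Rintegral do rewrite Im_mulc.
by rewrite RintegralD ?RintegralZl//; exact: Z.
Qed.

Lemma disc_integral_cst (R : realType) (w : R[i]) :
  disc_integral (fun=> w) = w * (fine (area (@disc_xy R)))%:C.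
Proof.
have mD := @measurable_disc_xy R.
by apply: complex_ext; rewrite /= Rintegral_cst//; case: w => a b /=; ring.
Qed.

(** Fubini over horizontal chords for the direction 1 and over vertical chords for the direction
    ['i]; each chord contributes 0. *)
Lemma disc_integral_kdir (R : realType) (a c : R[i]) (e : kexp R) :
  normc a < 1 -> normc c < 1 ->
  (forall z, normc z = 1 -> keval a c e z = 0) ->
  disc_integral (keval a c (kdir a c 1 e)) = 0 /\
  disc_integral (keval a c (kdir a c 'i e)) = 0.
Proof.
move=> a1 c1 e0.
have sq (t : R) : t ^+ 2 < 1 ->
    0 < Num.sqrt (1 - t ^+ 2) /\ Num.sqrt (1 - t ^+ 2) ^+ 2 = 1 - t ^+ 2.
  by rewrite -subr_gt0 => t1; rewrite sqrtr_gt0 sqr_sqrtr ?ltW.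
have hx (x y : R) : x +i* y = 0 +i* y + x%:C * 1 by apply: complex_ext => /=; ring.
have hy (x y : R) : x +i* y = x%:C + y%:C * 'i by apply: complex_ext => /=; ring.
have nx (y : R) : y ^+ 2 < 1 -> forall x : R,
    normc (0 +i* y + x%:C * 1) ^+ 2 = 1 - Num.sqrt (1 - y ^+ 2) ^+ 2 + x ^+ 2.
  by move=> /sq[_ ->] x; rewrite -hx normc_sqr /=; ring.
have ny (x : R) : x ^+ 2 < 1 -> forall y : R,
    normc (x%:C + y%:C * 'i) ^+ 2 = 1 - Num.sqrt (1 - x ^+ 2) ^+ 2 + y ^+ 2.
  by move=> /sq[_ ->] y; rewrite -hy normc_sqr /=; ring.
have [i1 i2] := integrable_keval (kdir a c 1 e) a1 c1.
have [j1 j2] := integrable_keval (kdir a c 'i e) a1 c1.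
split; apply: complex_ext.
- apply: (disc_fubini_x i1) => y y1; under eq_integral do rewrite [_ +i* _]hx.
  exact: (integral_kdir_line a1 c1 (sq _ y1).1 (nx _ y1) e0).1.
- apply: (disc_fubini_x i2) => y y1; under eq_integral do rewrite [_ +i* _]hx.
  exact: (integral_kdir_line a1 c1 (sq _ y1).1 (nx _ y1) e0).2.
- apply: (disc_fubini_y j1) => x x1; under eq_integral do rewrite (hy x).
  exact: (integral_kdir_line a1 c1 (sq _ x1).1 (ny _ x1) e0).1.
- apply: (disc_fubini_y j2) => x x1; under eq_integral do rewrite (hy x).
  exact: (integral_kdir_line a1 c1 (sq _ x1).1 (ny _ x1) e0).2.
Qed.

(** With I1 and I2 the integrals of the two Wirtinger derivatives, the directions 1 and ['i] give I1
    + I2 = 0 and i (I1 - I2) = 0. *)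
Lemma disc_integral_kd (R : realType) (a c : R[i]) (e : kexp R) :
  normc a < 1 -> normc c < 1 ->
  (forall z, normc z = 1 -> keval a c e z = 0) ->
  disc_integral (keval a c (kd a e)) = 0 /\
  disc_integral (keval a c (kdbar c e)) = 0.
Proof.
move=> a1 c1 e0; have [] := disc_integral_kdir a1 c1 e0.
rewrite /kdir !disc_integralD// !disc_integralZ//.
set I1 := disc_integral _; set I2 := disc_integral _.
rewrite (_ : 1^* = 1 :> R[i]); last by apply: complex_ext; rewrite /= ?oppr0.
rewrite (_ : 'i^* = - 'i :> R[i]); last by apply: complex_ext; rewrite /= ?oppr0.
rewrite !mul1r mulNr -mulrBr => h1 /eqP; rewrite mulf_eq0.
rewrite eq_complex /= oner_eq0 andbF /= subr_eq0 => /eqP h2.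
have : I2 *+ 2 = 0 by rewrite mulr2n -{1}h2.
move=> /eqP; rewrite mulrn_eq0/= => /eqP h3.
by rewrite h3 h2 h3.
Qed.

(** * The reproducing property for kernels *)

(** The weight 1 - |z|^2: its product with any expression vanishes on the unit circle, as
    [disc_integral_kd] requires. *)
Definition kweight (R : realType) : kexp R := KAdd (KC 1) (KMul (KC (-1)) (KMul KZ KZb)).

Lemma kweight0 (R : realType) (a c z : R[i]) (e : kexp R) :
  normc z = 1 -> keval a c (KMul (kweight R) e) z = 0.
Proof. by move=> z1; rewrite /= mulcJ z1 expr1n; ring. Qed.

Lemma disc_integral_conj_kernel (R : realType) (c : R[i]) : normc c < 1 ->
  disc_integral (fun z => (1 - c * z^*)^-1 ^+ 2) = (fine (area (@disc_xy R)))%:C.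
Proof.
move=> c1.
(* With w = c conj z, the z-derivative of the weighted [q] is - conj z q = ((1 - w)^2 - 1) / (1 -
   w)^2, that is 1 minus the integrand. *)
pose q : kexp R := KMul (KC c) (KMul (KAdd (KC 2) (KMul (KC (- c)) KZb)) (KMul KV KV)).
have := (disc_integral_kd c1 c1 (fun z => @kweight0 R c c z q)).1.
rewrite (@eq_disc_integral _ _ (keval c c
    (KAdd (KC 1) (KMul (KC (-1)) (KMul KV KV))))); last first.
  move=> z z1 /=; have := @sub1Mneq0 _ c z^* c1.
  rewrite normcJ => /(_ (ltW z1)) n0.
  by field.
rewrite disc_integralD// disc_integralZ// disc_integral_cst mul1r mulN1r => /eqP.
by rewrite subr_eq0 => /eqP ->; apply: eq_disc_integral => z _; rewrite expr2.
Qed.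

(** Reproducing property at [c] for f z = (1 - a z)^-2: Stokes replaces f z by the constant f c, and
    [disc_integral_conj_kernel] integrates what remains. *)
Lemma disc_integral_kernels (R : realType) (a c : R[i]) : normc a < 1 -> normc c < 1 ->
  disc_integral (fun z => (1 - a * z)^-1 ^+ 2 * (1 - c * z^*)^-1 ^+ 2) =
  (1 - a * c)^-1 ^+ 2 * (fine (area (@disc_xy R)))%:C.
Proof.
move=> a1 c1.
have ac : 1 - a * c != 0 by apply: sub1Mneq0 => //; apply: ltW.
(* The difference quotient (f z - f c) / (z - c); the dbar-derivative of the weighted [q] times [KV]
   is then (f c - f z) / (1 - c conj z)^2. *)
pose q : kexp R := KMul (KC (a * (1 - a * c)^-1 ^+ 2))
  (KMul (KAdd (KC (2 - a * c)) (KMul (KC (- a)) KZ)) (KMul KU KU)).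
have := (disc_integral_kd a1 c1 (fun z => @kweight0 R a c z (KMul q KV))).2.
pose UV : kexp R := KMul (KMul KU KU) (KMul KV KV).
rewrite (@eq_disc_integral _ _ (keval a c
    (KAdd (KMul (KC ((1 - a * c)^-1 ^+ 2)) (KMul KV KV))
          (KMul (KC (-1)) UV)))); last first.
  move=> z z1 /=; have := @sub1Mneq0 _ c z^* c1.
  rewrite normcJ => /(_ (ltW z1)) n0.
  have n1 := sub1Mneq0 a1 (ltW z1).
  by field; rewrite n0 n1 ac.
rewrite disc_integralD// !disc_integralZ//.
rewrite [disc_integral (keval a c (KMul KV KV))]
    (_ : _ = (fine (area (@disc_xy R)))%:C); last first.
  by rewrite -(disc_integral_conj_kernel c1); apply: eq_disc_integral => z _; rewrite expr2.
rewrite mulN1r => /eqP; rewrite subr_eq0 => /eqP ->.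
by apply: eq_disc_integral => z _; rewrite !expr2.
Qed.

(** * The Berezin transform for holomorphic symbols *)

Lemma dV_integralE (R : realType) (h : R[i] -> R[i]) :
  dV_integral h = ((fine (area (@disc_xy R)))^-1)%:C * disc_integral h.
Proof.
by apply: complex_ext; rewrite /dV_integral /disc_integral ?Re_mulc ?Im_mulc /=; ring.
Qed.

(** Composition with multiplication by [zeta] only changes the kernel parameter to [l^* * zeta]. The
    scalar [n] lets the formula serve both the norm ([zeta] = 1, [n] = 1) and the Berezin
    transform. *)
Lemma bergman_inner_kernels (R : realType) (zeta l w : R[i]) (n : R) :
  normc zeta <= 1 -> normc l < 1 -> normc w < 1 ->
  bergman_inner (fun z => bergman_kernel l (zeta * z) / n%:C)
                (fun z => bergman_kernel w z / n%:C) =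
  (n^-1 ^+ 2)%:C * bergman_kernel l (zeta * w).
Proof.
move=> z1 l1 w1.
have a1 : normc (l^* * zeta) < 1.
  by rewrite normcM normcJ (le_lt_trans _ l1)// ler_piMr ?normc_ge0.
rewrite /bergman_inner dV_integralE.
rewrite (@eq_disc_integral _ _ (keval (l^* * zeta) w
    (KMul (KC (n^-1 ^+ 2)%:C) (KMul (KMul KU KU) (KMul KV KV))))); last first.
  move=> z _ /=; rewrite /bergman_kernel !div1r.
  have -> : Num.conj (((1 - Num.conj w * z) ^+ 2)^-1 / n%:C) =
      ((1 - w * Num.conj z) ^+ 2)^-1 / n%:C.
    rewrite rmorphM !fmorphV rmorphXn rmorphB rmorph1 rmorphM /= conjCK.
    by congr (_ / _); apply: complex_ext => //=; rewrite oppr0.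
  have -> : (n^-1 ^+ 2)%:C = n%:C^-1 * n%:C^-1 by rewrite rmorphXn fmorphV expr2.
  rewrite [_ * (zeta * z)]mulrA !expr2 !invfM.
  set U := (1 - _ * z)^-1; set V := (1 - w * _)^-1; set N := n%:C^-1.
  rewrite [LHS](_ : _ = U * U * N * (V * V * N))//.
  rewrite [RHS](_ : _ = N * N * (U * U * (V * V)))//.
  by ring.
rewrite disc_integralZ//.
rewrite [disc_integral _]
    (_ : _ = (1 - l^* * zeta * w)^-1 ^+ 2 * (fine (area (@disc_xy R)))%:C); last first.
  by rewrite -disc_integral_kernels//; apply: eq_disc_integral => z _; rewrite !expr2.
rewrite /bergman_kernel div1r [_ * (zeta * w)]mulrA.
have m0 : fine (area (@disc_xy R)) != 0 by rewrite gt_eqF// fine_area_gt0.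
by rewrite mulrCA; congr (_ * _); rewrite mulrCA -rmorphM mulVf// rmorph1 mulr1 exprVn.
Qed.

Lemma bergman_kernel_diag (R : realType) (l : R[i]) :
  bergman_kernel l l = ((1 - normc l ^+ 2)^-1 ^+ 2)%:C.
Proof.
rewrite /bergman_kernel div1r [_ * l]mulrC.
rewrite (_ : 1 - _ = (1 - normc l ^+ 2)%:C); last first.
  by rewrite mulcJ; apply: complex_ext; rewrite /= ?subr0.
by rewrite -rmorphXn -fmorphV -exprVn.
Qed.

Lemma bergman_norm_kernel (R : realType) (l : R[i]) : normc l < 1 ->
  bergman_norm (bergman_kernel l) = (1 - normc l ^+ 2)^-1.
Proof.
move=> l1; have p : 0 < 1 - normc l ^+ 2 by rewrite subr_gt0 expr_lt1 ?normc_ge0.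
rewrite /bergman_norm.
have := @bergman_inner_kernels R 1 l l 1; rewrite normc1 => /(_ (lexx _) l1 l1).
rewrite (_ : (fun z => _) = bergman_kernel l); last by apply/funext => z; rewrite mul1r divr1.
rewrite (_ : (fun z => _) = bergman_kernel l); last by apply/funext => z; rewrite divr1.
move=> ->; rewrite invr1 expr1n !mul1r bergman_kernel_diag.
by rewrite /= sqrtr_sqr gtr0_norm// invr_gt0.
Qed.

Lemma berezin_transform_linear (R : realType) (zeta l : R[i]) :
  normc zeta <= 1 -> normc l < 1 ->
  berezin_transform (composition_operator (fun z => zeta * z)) l =
  berezin_pointwise (fun z => zeta * z) l.
Proof.
move=> z1 l1; rewrite /berezin_transform /composition_operator /normalized_kernel.
rewrite [LHS]bergman_inner_kernels// bergman_norm_kernel// invrK.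
by [].
Qed.

(** * Holomorphic symbols are linear *)

(** Combines exp y >= 1 + y at y = k ln u with ln u >= 1 - 1/u. It bounds the radial difference
    quotient from below. *)
Lemma powR_sub1_lb (R : realType) (u k : R) : 1 < u -> 0 <= k ->
  k * ((u - 1) / u) <= u `^ k - 1.
Proof.
move=> u1 k0; have u0 : 0 < u by lra.
rewrite /powR gt_eqF//.
have h1 : 1 + k * ln u <= expR (k * ln u) by apply: expR_ge1Dx.
have h2 : (u - 1) / u <= ln u.
  have ui : 0 < u^-1 by rewrite invr_gt0.
  have := @le_ln1Dx R (u^-1 - 1); rewrite (_ : 1 + _ = u^-1) ?lnV ?posrE//; last by ring.
  have -> : (u - 1) / u = 1 - u^-1 by rewrite mulrBl divff ?gt_eqF// mul1r.
  by rewrite ltrDr => /(_ ui) h; lra.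
rewrite lerBrDl (le_trans _ h1)// lerD2l ler_wpM2l//.
Qed.

Lemma complex_normE (R : realType) (z : R[i]) : `|z| = (normc z)%:C.
Proof. by []. Qed.

Lemma derivable_eps (R : realType) (f : R[i] -> R[i]) (z : R[i]) :
  derivable (f : R[i]^o -> R[i]^o) z 1 ->
  exists L : R[i], forall e : R, 0 < e -> exists2 d : R, 0 < d &
    forall h, h != 0 -> normc h < d -> normc (L - (f (h + z) - f z) / h) < e.
Proof.
move=> /cvg_ex[L /cvgrPdist_lt hL]; exists L => e e0.
have e0' : 0 < e%:C :> R[i] by rewrite ltcR.
have /nbhs_ballP[d /= d0 hd] := hL _ e0'.
(* A positive element of [R[i]] has zero imaginary part, so its real part is the same radius. *)
exists (Re d) => [|h h0 hh]; first by move: d0; rewrite ltcE /= => /andP[].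
have := hd h; rewrite /ball /= sub0r normrN => /(_ _ h0).
rewrite complex_normE ltcE /= hh andbT.
have -> : Im d == 0 by move: d0; rewrite ltcE /= => /andP[].
move=> /(_ isT).
by rewrite complex_normE ltcR [h *: 1]mulr1 [_ *: _]mulrC.
Qed.

Lemma holomorphic_twisted_power (R : realType) (zeta : R[i]) (k : R) : 0 <= k ->
  holomorphic_on_disc (twisted_power zeta k) ->
  twisted_power zeta k = (fun z => zeta * z).
Proof.
move=> k0 hol; have [z0|z0] := eqVneq zeta 0.
  by apply/funext => z; rewrite /twisted_power z0 !mul0r.
have [->|kn0] := eqVneq k 0.
  by apply/funext => z; rewrite /twisted_power powRr0 mulr1.
have {kn0 k0} k0 : 0 < k by rewrite lt_neqAle eq_sym kn0.
exfalso.
pose x : R := 2^-1; have x0 : 0 < x by rewrite invr_gt0.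
have nx : normc x%:C = x by rewrite normc_real gtr0_norm.
have dx : disc x%:C by rewrite /disc /= nx /x invf_lt1// ltr1n.
have [L hL] := derivable_eps (hol _ dx).
have zp : 0 < normc zeta by rewrite lt_neqAle eq_sym normc_eq0 z0 normc_ge0.
have xk : 0 < x `^ k by apply: powR_gt0.
pose c := normc zeta * x `^ k.
have c0 : 0 < c by apply: mulr_gt0.
(* At x = 1/2 the tangential quotient is [zeta] x^k and the radial one is at least 1 + k times it.
   They differ by at least [c * k] in modulus, so both cannot lie within half of that from [L]. *)
have e0 : 0 < c * k / 2 by apply: divr_gt0 => //; apply: mulr_gt0.
have [d d0 hd] := hL _ e0.
pose t : R := Num.min 1 d / 2.
have t0 : 0 < t by rewrite divr_gt0// lt_min ltr01.
have td : t < d.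
  have : Num.min 1 d <= d by rewrite ge_min lexx orbT.
  by rewrite /t; lra.
(* tangential direction: increments between points of equal modulus *)
have rot : normc (L - zeta * (x `^ k)%:C) < c * k / 2.
  (* A rational point of the unit circle near 1: |u - 1| <= 2t, so the increment from x = 1/2 to u x
     has modulus at most t. *)
  pose u : R[i] := (1 + t%:C * 'i) / (1 - t%:C * 'i).
  have den0 : 1 - t%:C * 'i != 0 :> R[i].
    rewrite eq_complex /= negb_and; apply/orP; left.
    by rewrite mulr0 mul0r subrr subr0 oner_eq0.
  have u1 : u - 1 = (2 * t)%:C * 'i / (1 - t%:C * 'i).
    rewrite /u -[X in _ - X](divff den0) -mulrBl; congr (_ / _).
    by apply: complex_ext => /=; ring.
  have nden : 1 <= normc (1 - t%:C * 'i).
    rewrite -(@expr_ge1 _ 2)// ?normc_ge0// normc_sqr /=; nra.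
  have nu : normc u = 1.
    rewrite /u normcM normcV.
    have -> : normc (1 + t%:C * 'i) = normc (1 - t%:C * 'i).
      by rewrite -normcJ; congr normc; apply: complex_ext => /=; ring.
    by rewrite divff// gt_eqF// (lt_le_trans _ nden).
  pose h := (u - 1) * x%:C.
  have h0 : h != 0.
    rewrite /h mulf_neq0//; last by rewrite -normc_eq0 nx gt_eqF.
    rewrite u1 mulf_neq0 ?invr_eq0// eq_complex /= negb_and; apply/orP; right.
    by rewrite !mulr1 mul0r addr0 mulf_eq0 pnatr_eq0 /= gt_eqF.
  have hn : normc h < d.
    rewrite /h normcM nx u1 !normcM normcV normc_real.
    have -> : normc ('i : R[i]) = 1.
      by apply/eqP; rewrite -(@eqrXn2 _ 2) ?normc_ge0// normc_sqr /= expr0n expr1n add0r.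
    rewrite mulr1 ger0_norm; last by rewrite mulr_ge0// ltW.
    apply: le_lt_trans td; rewrite mulrAC /x ler_pdivrMr ?(lt_le_trans _ nden)//.
    nra.
  have := hd h h0 hn.
  have -> : h + x%:C = u * x%:C by rewrite /h; ring.
  rewrite /twisted_power normcM nu mul1r nx.
  rewrite (_ : _ / h = zeta * (x `^ k)%:C)//.
  by rewrite /h; field; rewrite andbC -negb_or -mulf_eq0.
have rad : forall u : R, 1 < u -> (u - 1) * x < d ->
    normc (L - zeta * (x `^ k)%:C * ((u `^ k * u - 1) / (u - 1))%:C) < c * k / 2.
  move=> u u1 ud.
  pose h : R[i] := ((u - 1) * x)%:C.
  have up : 0 < (u - 1) * x by rewrite mulr_gt0// subr_gt0.
  have h0 : h != 0 by rewrite -normc_eq0 normc_real normr_eq0 gt_eqF.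
  have hn : normc h < d by rewrite normc_real gtr0_norm.
  have := hd h h0 hn.
  have -> : h + x%:C = (u * x)%:C by rewrite /h -rmorphD; congr _%:C; ring.
  rewrite /twisted_power nx normc_real gtr0_norm; last by rewrite mulr_gt0//; lra.
  rewrite powRM ?(ltW x0)//; last lra.
  rewrite (_ : _ / h = zeta * (x `^ k)%:C * ((u `^ k * u - 1) / (u - 1))%:C)//.
  have un : u - 1 != 0 by rewrite gt_eqF// subr_gt0.
  have xn : x != 0 by rewrite gt_eqF.
  apply: (canLR (mulfK h0)); rewrite /h; move: (x `^ k) (u `^ k) => A B.
  by case: (zeta) => a b; apply: complex_ext => /=; field.
have := rad (1 + t); rewrite addrAC subrr add0r ltrDl => /(_ t0).
have tx : t * x < d.
  by apply: le_lt_trans td; have : x * 2 = 1 by [rewrite mulVf]; nra.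
move=> /(_ tx) {}rad.
have u1 : 1 < 1 + t by rewrite ltrDl.
have := powR_sub1_lb u1 (ltW k0).
set A := (1 + t) `^ k in rad *; rewrite addrAC subrr add0r => hA.
(* Multiplying A - 1 >= k t / (1 + t) by 1 + t gives A (1 + t) - 1 >= t + k t. *)
have key : 1 + k <= (A * (1 + t) - 1) / t.
  rewrite ler_pdivlMr//.
  have : k * (t / (1 + t)) * (1 + t) <= (A - 1) * (1 + t).
    by rewrite ler_pM2r//; lra.
  have tn : 1 + t != 0 by apply: lt0r_neq0; lra.
  rewrite -mulrA divfK//.
  by move=> h; nra.
have lt1 : normc (zeta * (x `^ k)%:C * (((A * (1 + t) - 1) / t)%:C - 1)) < c * k.
  rewrite (_ : _ * (_ - 1) = (L - zeta * (x `^ k)%:C) +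
     - (L - zeta * (x `^ k)%:C * ((A * (1 + t) - 1) / t)%:C)); last by ring.
  apply: le_lt_trans (ler_normcD _ _) _.
  by rewrite normc_opp [X in _ < X](splitr (c * k)) ltrD.
move: lt1; set Q := (A * (1 + t) - 1) / t in key *.
rewrite (_ : Q%:C - 1 = (Q - 1)%:C); last by apply: complex_ext; rewrite /= ?subr0.
rewrite !normcM !normc_real (gtr0_norm xk) -/c ger0_norm; last by lra.
by rewrite ltr_pM2l// => ?; lra.
Qed.

(** * The Berezin curve *)

Lemma convex_complexP (R : realType) (A : set R[i]) :
  convex_complex A <->
  forall (x y : R[i]) (t : R), A x -> A y -> 0 <= t <= 1 ->
    A (t%:C * x + (1 - t)%:C * y).
Proof.
have E (x y : Rcomplex R) (p : {i01 R}) :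
    conv p (x : convex_lmodType (Rcomplex R)) y =
    (p%:num%:C * x + (1 - p%:num)%:C * y : R[i]).
  case: x y => [a b] [c d]; rewrite /conv /=.
  by apply: complex_ext => /=; rewrite /unstable.onem; ring.
split=> [cA x y t Ax Ay t01|cA x y p /set_mem Ax /set_mem Ay]; last first.
  apply/mem_set; rewrite E; apply: cA => //.
  by rewrite ge0 /= le1.
have := cA x y (Itv01 (proj1 (andP t01)) (proj2 (andP t01))) (mem_set Ax) (mem_set Ay).
by move=> /set_mem; rewrite E.
Qed.

(** For negative [x] the power is 1 by convention; [radial_continuous] needs this on the left of
    0. *)
Lemma powR_le1 (R : realType) (x k : R) : x <= 1 -> 0 <= k -> x `^ k <= 1.
Proof.
move=> x1 k0; have [xn|xp|->] := ltgtP x 0.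
- by rewrite lt0_powR1.
- by rewrite -(powRr0 x) ger_powR// xp x1.
- by rewrite /powR eqxx; case: (k == 0); rewrite ?ler01.
Qed.

Definition radial (R : realType) (k r : R) : R := r `^ k * r ^+ 2.

Lemma radial_ge0 (R : realType) (k r : R) : 0 <= radial k r.
Proof. by rewrite mulr_ge0 ?powR_ge0 ?sqr_ge0. Qed.

Lemma radial_lt1 (R : realType) (k r : R) : 0 <= k -> 0 <= r < 1 -> radial k r < 1.
Proof.
move=> k0 /andP[r0 r1]; apply: (@le_lt_trans _ _ (r ^+ 2)); last by rewrite expr_lt1.
by rewrite ler_piMl ?sqr_ge0// powR_le1// ltW.
Qed.

Lemma radial_lt (R : realType) (k r s : R) : 0 <= k -> 0 <= r -> r < s ->
  radial k r < radial k s.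
Proof.
move=> k0 r0 rs; have s0 : 0 < s by apply: le_lt_trans rs.
apply: (@le_lt_trans _ _ (s `^ k * r ^+ 2)).
  by rewrite ler_wpM2r ?sqr_ge0// ge0_ler_powR ?nnegrE// ltW.
by rewrite ltr_pM2l ?powR_gt0// ltr_pXn2r ?nnegrE// ltW.
Qed.

Lemma radial_inj (R : realType) (k r s : R) : 0 <= k -> 0 <= r -> 0 <= s ->
  radial k r = radial k s -> r = s.
Proof.
move=> k0 r0 s0 rs; have [h|h|//] := ltgtP r s.
  by have := radial_lt k0 r0 h; rewrite rs ltxx.
by have := radial_lt k0 s0 h; rewrite rs ltxx.
Qed.

(** At 0 the factor [powR] may jump, but it is at most 1 nearby, so [radial] is squeezed between 0
    and x^2 <= |x|. *)
Lemma radial_continuous (R : realType) (k r : R) : 0 <= k -> 0 <= r ->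
  {for r, continuous (radial k)}.
Proof.
move=> k0; rewrite le_eqVlt => /predU1P[<-|r0].
  apply/cvgrPdist_lt => e e0; rewrite [radial k _](_ : _ = 0); last first.
    by rewrite /radial expr0n/= mulr0.
   apply/nbhs_ballP.
  exists (Num.min 1 e); first by rewrite /= lt_min ltr01.
  move=> x; rewrite /ball /= !sub0r !normrN lt_min => /andP[x1 xe].
  rewrite ger0_norm ?radial_ge0//; apply: le_lt_trans xe.
  have x1' : x <= 1 by apply: le_trans (ler_norm x) (ltW x1).
  apply: (@le_trans _ _ (x ^+ 2)); first by rewrite ler_piMl ?sqr_ge0// powR_le1.
  by rewrite -real_normK ?num_real// expr2 ler_piMl// ltW.
apply: continuousM; last exact: exprn_continuous.
apply: differentiable_continuous; apply/derivable1_diffP.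
by apply: derivable_powR; rewrite in_itv /= r0.
Qed.

Definition berezin_curve (R : realType) (zeta : R[i]) (k r : R) : R[i] :=
  ((1 - r ^+ 2) ^+ 2)%:C * (1 - zeta * (radial k r)%:C)^-1 ^+ 2.

Lemma berezin_pointwise_rangeE (R : realType) (zeta : R[i]) (k : R) :
  berezin_pointwise_range (twisted_power zeta k) =
  [set berezin_curve zeta k r | r in [set r : R | 0 <= r < 1]].
Proof.
have E l : berezin_pointwise (twisted_power zeta k) l = berezin_curve zeta k (normc l).
  rewrite /berezin_pointwise /bergman_kernel /berezin_curve /twisted_power div1r exprVn.
  rewrite [_ * (zeta * _ * l)]mulrC -[_ * l * _]mulrA mulcJ -mulrA -rmorphM.
  by [].
apply/seteqP; split => [_ [l dl <-]|_ [r /andP[r0 r1] <-]].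
  by exists (normc l); rewrite ?E//= normc_ge0.
exists r%:C; first by rewrite /disc/= normc_real ger0_norm.
by rewrite E normc_real ger0_norm.
Qed.

(** Expands w^-2 = (conj w)^2 / |w|^4 for w = (1 - a s) - i b s. *)
Lemma berezin_curveE (R : realType) (zeta : R[i]) (k r : R) :
  let s := radial k r in
  let a := Re zeta in let b := Im zeta in
  let c := (1 - r ^+ 2) ^+ 2 / ((1 - a * s) ^+ 2 + (b * s) ^+ 2) ^+ 2 in
  Re (berezin_curve zeta k r) = c * ((1 - a * s) ^+ 2 - (b * s) ^+ 2) /\
  Im (berezin_curve zeta k r) = c * (2 * (1 - a * s) * (b * s)).
Proof.
move=> s a b c.
have e1 : Re (1 - zeta * s%:C) = 1 - a * s by rewrite /a; case: (zeta) => ? ? /=; ring.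
have e2 : Im (1 - zeta * s%:C) = - (b * s) by rewrite /b; case: (zeta) => ? ? /=; ring.
pose w := (1 - zeta * s%:C)^-1.
have -> : berezin_curve zeta k r = ((1 - r ^+ 2) ^+ 2)%:C * (w * w) by [].
split; rewrite /w !(Re_mulc, Im_mulc, Re_invc, Im_invc) e1 e2 /= sqrrN /c -exprVn.
  by ring.
by ring.
Qed.

Lemma berezin_curve_real_convex (R : realType) (t k : R) : 0 <= k -> -1 <= t <= 1 ->
  convex_complex (berezin_pointwise_range (twisted_power t%:C k)).
Proof.
move=> k0 /andP[t1 t2]; rewrite berezin_pointwise_rangeE.
pose f1 r : R := 1 - r ^+ 2.
pose f2 r : R := (1 - t * radial k r)^-1.
pose g r : R := f1 r * f1 r * (f2 r * f2 r).
have E r : berezin_curve t%:C k r = (g r)%:C.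
  rewrite /berezin_curve (_ : 1 - _ = (1 - t * radial k r)%:C); last first.
    by apply: complex_ext => /=; ring.
  by rewrite -fmorphV -rmorphXn -rmorphM.
have cg r : 0 <= r < 1 -> {for r, continuous g}.
  move=> r01; have [r0 r1] := andP r01.
  have cr := radial_continuous k0 r0.
  have p : 1 - t * radial k r != 0.
    by have := radial_ge0 k r; have := radial_lt1 k0 r01; move=> *; apply: lt0r_neq0; nra.
  have c1 : {for r, continuous f1}.
    by apply: cvgB; [exact: cvg_cst|exact: exprn_continuous].
  have c2 : {for r, continuous f2}.
    by apply: cvgV => //; apply: cvgB; [exact: cvg_cst|apply: cvgM => //; exact: cvg_cst].
  exact: (cvgM (cvgM c1 c1) (cvgM c2 c2)).
have ivt r s v : 0 <= r < 1 -> 0 <= s < 1 -> r <= s ->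
    Num.min (g r) (g s) <= v <= Num.max (g r) (g s) -> exists2 q, 0 <= q < 1 & g q = v.
  move=> /andP[r0 r1] /andP[s0 s1] rs hv.
  have cw : {within `[r, s], continuous g}.
    apply: continuous_in_subspaceT => q /set_mem /=; rewrite in_itv/= => /andP[rq qs].
    by apply: cg; rewrite (le_trans r0)// (le_lt_trans qs).
  have [q] := IVT rs cw hv; rewrite in_itv /= => /andP[rq qs] <-.
  by exists q => //; rewrite (le_trans r0)// (le_lt_trans qs).
apply/convex_complexP => _ _ u [r r01 <-] [s s01 <-] /andP[u0 u1].
(* A convex combination lies between the two values of [g], so the intermediate value theorem
   supplies the parameter. *)
suff [q q01 gq] : exists2 q, 0 <= q < 1 & g q = u * g r + (1 - u) * g s.
  by exists q => //; rewrite !E gq; apply: complex_ext => /=; ring.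
have hv : Num.min (g r) (g s) <= u * g r + (1 - u) * g s <= Num.max (g r) (g s).
  by case: (leP (g r) (g s)) => h; apply/andP; split; nra.
have [rs|sr] := leP r s; first exact: (ivt r s).
by apply: (ivt s r) => //; [exact: ltW|rewrite minC maxC].
Qed.

Lemma berezin_curve_nonreal_not_convex (R : realType) (zeta : R[i]) (k : R) :
  0 <= k -> normc zeta <= 1 -> Im zeta != 0 ->
  ~ convex_complex (berezin_pointwise_range (twisted_power zeta k)).
Proof.
move=> k0 z1 b0; rewrite berezin_pointwise_rangeE => /convex_complexP cvx.
pose a := Re zeta; pose b := Im zeta.
have b2 : 0 < b ^+ 2 by rewrite exprn_even_gt0.
have ab : a ^+ 2 + b ^+ 2 <= 1 by rewrite -normc_sqr expr_le1 ?normc_ge0.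
have a1 : a < 1 by nra.
have a1' : -1 < a by nra.
pose n s := (1 - a * s) ^+ 2 + (b * s) ^+ 2.
(* With m = a^2 + b^2 <= 1, one has m n(s) = (m s - a)^2 + b^2 >= b^2 >= m b^2. *)
have nb s : b ^+ 2 <= n s.
  have n0 : 0 < a ^+ 2 + b ^+ 2 by nra.
  rewrite -(ler_pM2l n0) /n.
  have : 0 <= ((a ^+ 2 + b ^+ 2) * s - a) ^+ 2 by apply: sqr_ge0.
  have : 0 <= b ^+ 2 * (1 - (a ^+ 2 + b ^+ 2)) by rewrite mulr_ge0 ?sqr_ge0// subr_ge0.
  nra.
have n0 s : 0 < n s by apply: lt_le_trans (nb s).
pose c r := (1 - r ^+ 2) ^+ 2 / n (radial k r) ^+ 2.
have c0 r : 0 <= r < 1 -> 0 < c r.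
  move=> /andP[r0 r1]; apply: divr_gt0; last exact: exprn_gt0.
  by apply: exprn_gt0; rewrite subr_gt0 expr_lt1.
have as1 r : 0 <= r < 1 -> 0 < 1 - a * radial k r.
  by move=> /(radial_lt1 k0); have := radial_ge0 k r; nra.
have ReE r : Re (berezin_curve zeta k r) =
    c r * ((1 - a * radial k r) ^+ 2 - (b * radial k r) ^+ 2).
  by have [] := berezin_curveE zeta k r.
have ImE r : Im (berezin_curve zeta k r) =
    c r * (2 * (1 - a * radial k r) * (b * radial k r)).
  by have [] := berezin_curveE zeta k r.
pose r0 : R := 2^-1.
have r001 : 0 <= r0 < 1 by rewrite invr_ge0 ler0n invf_lt1// ltr1n.
pose P := berezin_curve zeta k r0.
pose s0 := radial k r0.
have s0p : 0 < s0 by rewrite mulr_gt0 ?powR_gt0 ?exprn_gt0 ?invr_gt0.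
(* This is Im (z conj P), zero exactly when z is on the real line through 0 and P. On the curve it
   is a positive factor times b (s - s0), so its only zero there is P. *)
pose cross z := Im z * Re P - Re z * Im P.
have crossE r : cross (berezin_curve zeta k r) =
    2 * c r * c r0 * ((1 - a * radial k r) * (1 - a * s0) + b ^+ 2 * (radial k r * s0)) *
    (b * (radial k r - s0)).
  by rewrite /cross /P !ReE !ImE -/s0; ring.
have Xp r : 0 <= r < 1 ->
    0 < 2 * c r * c r0 * ((1 - a * radial k r) * (1 - a * s0) + b ^+ 2 * (radial k r * s0)).
  move=> r01; have := as1 _ r01; have := as1 _ r001; rewrite -/s0 => h1 h2.
  apply: mulr_gt0; first by apply: mulr_gt0; [apply: mulr_gt0|]; rewrite ?c0.
  apply: ltr_wpDr; last exact: mulr_gt0.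
  by rewrite mulr_ge0 ?sqr_ge0// mulr_ge0 ?radial_ge0// ltW.
have ImP : Im P = 2 * c r0 * (1 - a * s0) * s0 * b by rewrite ImE -/s0; ring.
have Yp : 0 < 2 * c r0 * (1 - a * s0) * s0.
  apply: mulr_gt0 => //; apply: mulr_gt0; last exact: as1.
  by apply: mulr_gt0; rewrite ?c0.
have ImP0 : Im P != 0 by rewrite ImP mulf_neq0// gt_eqF.
(* The chord from the value 1 (at r = 0) to the value at r crosses the ray
   through P, and P is the only point of the curve on that ray. *)
have key r : r0 < r -> r < 1 -> `|Im P| <= `|Im (berezin_curve zeta k r)|.
  move=> rr r1; have r01 : 0 <= r < 1.
    by rewrite r1 andbT; apply: le_trans (ltW rr); case/andP: r001.
  have sr : s0 < radial k r by apply: radial_lt => //; case/andP: r001.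
  pose w := berezin_curve zeta k r.
  have [X X0 cw] : exists2 X, 0 < X & cross w = X * b.
    exists (2 * c r * c r0 * ((1 - a * radial k r) * (1 - a * s0) + b ^+ 2 * (radial k r * s0)) *
      (radial k r - s0)).
      by rewrite mulr_gt0 ?Xp// subr_gt0.
    by rewrite crossE; ring.
  pose Y := 2 * c r0 * (1 - a * s0) * s0.
  have XY : 0 < X + Y by apply: addr_gt0.
  (* Since [cross] is - Y b at 1 and X b at w, this weight makes it vanish at t + (1 - t) w. *)
  pose t := X / (X + Y).
  have t01 : 0 <= t <= 1.
    apply/andP; split; first by apply: divr_ge0; apply: ltW.
    by rewrite ler_pdivrMr// mul1r lerDl ltW.
  have one : berezin_curve zeta k 0 = 1.
    by rewrite /berezin_curve /radial expr0n /= !mulr0 subr0 expr1n subr0 invr1 expr1n mulr1.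
  have z01 : [set berezin_curve zeta k r | r in [set r : R | 0 <= r < 1]] 1.
    by exists 0 => //=; rewrite lexx ltr01.
  have w01 : [set berezin_curve zeta k r | r in [set r : R | 0 <= r < 1]] w by exists r.
  have [q q01 qE] := cvx _ _ t z01 w01 t01.
  have ReQ : Re (berezin_curve zeta k q) = t + (1 - t) * Re w.
    by rewrite qE Re_addc !Re_mulc /=; ring.
  have ImQ : Im (berezin_curve zeta k q) = (1 - t) * Im w.
    by rewrite qE Im_addc !Im_mulc /=; ring.
  have c0q : cross (berezin_curve zeta k q) = 0.
    have -> : cross (berezin_curve zeta k q) = - (t * Im P) + (1 - t) * cross w.
      by rewrite /cross ReQ ImQ; ring.
    rewrite cw ImP -/Y /t; field.
    by rewrite gt_eqF.
  have qr : q = r0.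
    apply: (@radial_inj _ k) => //; [by case/andP: q01|by case/andP: r001|].
    move: c0q; rewrite crossE => /eqP; rewrite mulf_eq0 gt_eqF ?Xp//=.
    by rewrite mulf_eq0 (negbTE b0) /= subr_eq0 => /eqP.
  rewrite /P -qr ImQ normrM ler_piMl// ger0_norm; case/andP: t01; lra.
(* Since |1 - zeta s| >= |b|, taking r^2 = 1 - h with h^2 < b^2 |Im P| makes the
   value at r too small. *)
pose e := b ^+ 2 * `|Im P|.
have e0 : 0 < e by rewrite mulr_gt0// normr_gt0.
pose h := Num.min 1 e / 2.
have h0 : 0 < h by rewrite divr_gt0// lt_min ltr01.
have [h1 he] : h <= 2^-1 /\ h < e.
  have : Num.min 1 e <= e by rewrite ge_min lexx orbT.
  have : Num.min 1 e <= 1 by rewrite ge_min lexx.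
  by rewrite /h => *; split; lra.
pose r := Num.sqrt (1 - h).
have r2 : r ^+ 2 = 1 - h by rewrite sqr_sqrtr//; lra.
have rp : 0 <= r by apply: sqrtr_ge0.
have r1 : r < 1 by rewrite -(@expr_lt1 _ 2)// r2; lra.
have rr : r0 < r.
  rewrite -(@ltr_pXn2r _ 2)// ?nnegrE ?invr_ge0 ?ler0n// r2 /r0.
  have : (2^-1 : R) ^+ 2 = 2^-1 / 2 by rewrite expr2.
  lra.
have := key r rr r1; rewrite ImE.
have r01 : 0 <= r < 1 by rewrite rp.
rewrite normrM gtr0_norm ?c0// /c r2 => hk.
(* This is |2 u v| <= u^2 + v^2, so the imaginary part at r has modulus at most h^2 / n. *)
have : `|2 * (1 - a * radial k r) * (b * radial k r)| <= n (radial k r).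
  rewrite ler_norml /n; set u := 1 - a * _; set v := b * _.
  have : 0 <= (u - v) ^+ 2 by apply: sqr_ge0.
  have : 0 <= (u + v) ^+ 2 by apply: sqr_ge0.
  by move=> *; apply/andP; split; nra.
move=> hn; have := n0 (radial k r); have := nb (radial k r).
move: hk hn; set N := n (radial k r); set M := `|2 * _ * _| => hk hn bN N0.
(* The contradiction is the chain e <= |Im P| N <= h^2 <= h < e. *)
have : `|Im P| * N <= h ^+ 2.
  apply: (@le_trans _ _ ((1 - (1 - h)) ^+ 2 / N ^+ 2 * M * N)).
    by rewrite ler_wpM2r// ltW.
  have -> : (1 - (1 - h)) ^+ 2 / N ^+ 2 * M * N = h ^+ 2 * (M / N).
    by field; rewrite gt_eqF.
  by rewrite ler_piMr ?sqr_ge0// ler_pdivrMr// mul1r.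
have : `|Im P| * b ^+ 2 <= `|Im P| * N by rewrite ler_wpM2l.
rewrite mulrC -/e => g1 g2.
have : h ^+ 2 <= h by rewrite expr2 ler_piMl// ?ltW//; lra.
lra.
Qed.

(** * The convexity criterion *)

Lemma berezin_pointwise_range_convex (R : realType) (zeta : R[i]) (k : R) :
  closed_disc zeta -> 0 <= k ->
  convex_complex (berezin_pointwise_range (twisted_power zeta k)) <->
  exists2 t : R, -1 <= t <= 1 & zeta = t%:C.
Proof.
move=> z1 k0; split=> [cvx|[t t1 ->]]; last exact: berezin_curve_real_convex.
have [b0|b0] := eqVneq (Im zeta) 0; last first.
  by case: (berezin_curve_nonreal_not_convex k0 z1 b0).
exists (Re zeta); last exact: complex_ext.
by rewrite -ler_norml (le_trans (Re_le_normc _)).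
Qed.

Theorem theorem3p5 (R : realType) (zeta : R[i]) (k : R)
    (hzeta : closed_disc zeta) (hk : 0 <= k) :
  (holomorphic_on_disc (twisted_power zeta k) ->
    (convex_complex
       (berezin_range (composition_operator (twisted_power zeta k))) <->
     exists2 t : R, -1 <= t <= 1 & zeta = t%:C)) /\
  (convex_complex (berezin_pointwise_range (twisted_power zeta k)) <->
   exists2 t : R, -1 <= t <= 1 & zeta = t%:C).
Proof.
have main := berezin_pointwise_range_convex hzeta hk.
split=> // hol; rewrite -main.
(* For a holomorphic, hence linear, symbol the integral and pointwise transforms agree on the
   disc. *)
suff -> : berezin_range (composition_operator (twisted_power zeta k)) =
    berezin_pointwise_range (twisted_power zeta k) by [].
apply: eq_imagel => l dl; rewrite (holomorphic_twisted_power hk hol).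
exact: berezin_transform_linear.
Qed.
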